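(* Let $n\ge 3$. The maximum of the elementary submodular rank over all functions $f:\{0,1\}^n\to\mathbb{R}$ is $n$. Moreover, every supermodular function in the interior of $\mathcal{L}_{(1,\ldots,1)}$ has elementary submodular rank $n$.
   Context: A tuple $\pi=(\pi_1,\ldots,\pi_n)$ of linear orders on $\{0,1\}$ defines a product order on $\{0,1\}^n$: $x\le_\pi y$ iff $x_i\le_{\pi_i}y_i$ for all $i$; it is a lattice order with meet $\wedge$ and join $\vee$ depending on $\pi$. A function $f$ is $\pi$-supermodular if $f(x)+f(y)\le f(x\wedge y)+f(x\vee y)$ for all $x,y$, and $\pi$-submodular if $-f$ is $\pi$-supermodular. The sign vector $\tau\in\{\pm1\}^n$ of $\pi$ has $\tau_i=1$ if $0<_{\pi_i}1$ and $\tau_i=-1$ if $1<_{\pi_i}0$; $\mathcal{L}_\tau=\mathcal{L}_\pi\subseteq\mathbb{R}^{\{0,1\}^n}$ is the cone of $\pi$-supermodular functions, and $-\mathcal{L}_\tau$ the cone of $\pi$-submodular functions. $\mathcal{L}_{(1,\ldots,1)}$ is the cone of ordinary supermodular functions. A function is called $\{i\}$-submodular if it lies in $-\mathcal{L}_\tau$ for the $\tau$ whose unique entry equal to $-1$ is in coordinate $i$. The elementary submodular rank of $f:\{0,1\}^n\to\mathbb{R}$ is the smallest $r+1$ (with $r\ge0$) such that $f=f_0+f_{i_1}+\cdots+f_{i_r}$, where $f_0\in-\mathcal{L}_{(1,\ldots,1)}$ and $f_{i_j}$ is $\{i_j\}$-submodular for some $i_1,\ldots,i_r\in[n]$. *)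

(* Defs.v *)
From HB Require Import structures.
From mathcomp Require Import all_boot all_order all_algebra.
From mathcomp Require Import all_classical all_reals all_analysis.

Set Implicit Arguments.
Unset Strict Implicit.
Unset Printing Implicit Defensive.

Import Order.TTheory GRing.Theory Num.Theory.
Import numFieldNormedType.Exports.

Local Open Scope classical_set_scope.
Local Open Scope ring_scope.

(* {0,1}^n, with false = 0 and true = 1. *)
Definition cube (n : nat) := {ffun 'I_n -> bool}.

Definition linear_order (r : rel bool) : Prop :=
  [/\ reflexive r, antisymmetric r, transitive r & total r].

Definition product_order n (pi : 'I_n -> rel bool) (x y : cube n) : Prop :=
  forall i, pi i (x i) (y i).

Definition meet n (pi : 'I_n -> rel bool) (x y : cube n) : cube n :=
  [ffun i => if pi i (x i) (y i) then x i else y i].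

Definition join n (pi : 'I_n -> rel bool) (x y : cube n) : cube n :=
  [ffun i => if pi i (x i) (y i) then y i else x i].

Definition supermodular (R : realType) n (pi : 'I_n -> rel bool) :
    set (cube n -> R) :=
  [set f | forall x y, f x + f y <= f (meet pi x y) + f (join pi x y)].

Definition submodular (R : realType) n (pi : 'I_n -> rel bool) :
    set (cube n -> R) :=
  [set f | supermodular pi (fun x => - f x)].

(* A sign is encoded by the boolean s standing for (-1) ^+ s: the sign +1
   (s = false) gives the linear order 0 < 1, the sign -1 (s = true) gives
   1 < 0. *)
Definition sign_order (s : bool) : rel bool :=
  fun a b => if s then b ==> a else a ==> b.

Definition sign_vector (n : nat) := {ffun 'I_n -> bool}.

(* L_tau and -L_tau *)
Definition supermodular_cone (R : realType) n (tau : sign_vector n) :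
    set (cube n -> R) :=
  supermodular (fun i => sign_order (tau i)).

Definition submodular_cone (R : realType) n (tau : sign_vector n) :
    set (cube n -> R) :=
  submodular (fun i => sign_order (tau i)).

Definition all_plus (n : nat) : sign_vector n := [ffun=> false].

Definition minus_at n (i : 'I_n) : sign_vector n := [ffun j => j == i].

Definition elementary_decomposition (R : realType) n (f : cube n -> R)
    (r : nat) : Prop :=
  exists (f0 : cube n -> R) (i : 'I_r -> 'I_n) (g : 'I_r -> cube n -> R),
    [/\ submodular_cone (all_plus n) f0,
        forall j, submodular_cone (minus_at (i j)) (g j) &
        forall x, f x = f0 x + \sum_(j < r) g j x].

Definition is_minimum (A : set nat) (k : nat) : Prop :=
  A k /\ forall m, A m -> (k <= m)%N.

Definition is_maximum (A : set nat) (k : nat) : Prop :=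
  A k /\ forall m, A m -> (m <= k)%N.

(* The rank is given by its graph, so that its existence is a claim rather
   than a convention; it is unique by elementary_submodular_rank_uniq. *)
Definition elementary_submodular_rank (R : realType) n (f : cube n -> R)
    (k : nat) : Prop :=
  is_minimum [set r.+1 | r in [set r | elementary_decomposition f r]] k.

(* The topology of pointwise convergence on R^({0,1}^n) is the usual
   Euclidean one, as {0,1}^n is finite. *)
Definition interior_supermodular_cone (R : realType) n (tau : sign_vector n) :
    set (cube n -> R) :=
  interior (supermodular_cone tau : set {ptws cube n -> R}).

Lemma linear_orderP (r : rel bool) :
  linear_order r <-> exists s, r =2 sign_order s.
Proof.
split=> [[r_refl r_anti _ r_tot]|[s rs]].
  exists (~~ r false true) => a b; move: (r_anti false true) (r_tot false true).
  by case: a b => [] []; rewrite ?r_refl /sign_order;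
    case: (r false true); case: (r true false) => //= /(_ isT).
by split; [move=> a|move=> a b|move=> a b c|move=> a b]; rewrite !rs;
  move: s {rs} => []; do ?[case: a]; do ?[case: b]; do ?[case: c].
Qed.

Lemma meetP n (pi : 'I_n -> rel bool) (x y z : cube n) :
  (forall i, linear_order (pi i)) ->
  product_order pi z (meet pi x y) <->
  product_order pi z x /\ product_order pi z y.
Proof.
move=> lin; split=> [h|[zx zy] i].
  split=> i; move: (h i); rewrite ffunE; have [_ _ tr tot] := lin i.
    case: ifP => // /negbT xy zy; apply: tr zy _.
    by have := tot (x i) (y i); rewrite (negbTE xy).
  by case: ifP => // xy zx; apply: tr zx xy.
by rewrite ffunE; case: ifP.
Qed.

Lemma joinP n (pi : 'I_n -> rel bool) (x y z : cube n) :
  (forall i, linear_order (pi i)) ->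
  product_order pi (join pi x y) z <->
  product_order pi x z /\ product_order pi y z.
Proof.
move=> lin; split=> [h|[xz yz] i].
  split=> i; move: (h i); rewrite ffunE; have [_ _ tr tot] := lin i.
    by case: ifP => // xy; apply: tr xy.
  case: ifP => // /negbT xy; apply: tr.
  by have := tot (x i) (y i); rewrite (negbTE xy).
by rewrite ffunE; case: ifP.
Qed.

Lemma elementary_submodular_rank_uniq (R : realType) n (f : cube n -> R) k l :
  elementary_submodular_rank f k -> elementary_submodular_rank f l -> k = l.
Proof.
by move=> [fk kmin] [fl lmin]; apply/eqP; rewrite eqn_leq kmin ?lmin.
Qed.

(* Main.v *)
Require Import Defs.
From mathcomp Require Import all_boot all_order all_algebra.
From mathcomp Require Import all_classical all_reals all_analysis.
From mathcomp Require Import lra zify.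

Set Implicit Arguments.
Unset Strict Implicit.
Unset Printing Implicit Defensive.

Import Order.TTheory GRing.Theory Num.Theory.
Import numFieldNormedType.Exports.

Local Open Scope classical_set_scope.

(** The sign of the excess f (x /\ y) + f (x \/ y) - f x - f y decides
    membership in the cones, and the excess is linear in f.

    At most n summands suffice.  The quadratic monomial sum
    star k x = x_k * sum_(j != k) x_j is {k}-submodular, yet it is also
    ordinarily supermodular, and strictly so on any incomparable pair x, y
    with x_k != y_k.  An incomparable pair differs in at least two
    coordinates, x exceeding y in one and y exceeding x in another, so at
    least one of them is not coordinate 0.  Hence the n - 1 functions star k
    with k != 0 already add up to a function q whose excess is at least 1 on
    every incomparable pair, and f - c q is submodular as soon as c dominates
    every excess of f (elementary_decomposition_exists).

    Fewer summands fail.  With r < n - 1 elementary summands, two coordinates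
    i != j are missed by the indices used.  Every summand is then submodular
    with respect to orders that agree with 0 < 1 on both i and j, and so it
    has nonpositive excess on the pair e_i, e_j, just like an ordinary
    submodular function; so does their sum
    (elementary_decomposition_units).  An f whose excess is positive on all
    pairs e_i, e_j therefore has rank exactly n.  The function q is one
    example; points of the interior of the supermodular cone are others,
    since increasing f at the single point e_i lowers that excess and a small
    increase stays inside the cone (interior_excess_gt0). *)

(** * The excess on a pair of points *)

Section Excess.
Local Open Scope ring_scope.
Variables (R : realType) (n : nat).
Implicit Types (pi : 'I_n -> rel bool) (tau : sign_vector n).
Implicit Types (f g : cube n -> R) (x y : cube n).

Definition excess pi f x y : R :=
  f (meet pi x y) + f (join pi x y) - (f x + f y).

Definition cone_excess tau := excess (fun i => sign_order (tau i)).

Lemma supermodular_coneP tau f :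
  supermodular_cone tau f <-> forall x y, 0 <= cone_excess tau f x y.
Proof.
by split=> h x y; have := h x y; rewrite /cone_excess /excess subr_ge0.
Qed.

Lemma submodular_coneP tau f :
  submodular_cone tau f <-> forall x y, cone_excess tau f x y <= 0.
Proof.
split=> h x y; have := h x y; rewrite /cone_excess /excess /=; lra.
Qed.

Lemma cone_excessC tau f x y : cone_excess tau f x y = cone_excess tau f y x.
Proof.
rewrite /cone_excess /excess [f x + f y]addrC; congr (f _ + f _ - _);
  apply/ffunP => i; rewrite !ffunE /sign_order;
  by case: (tau i); case: (x i); case: (y i).
Qed.

Lemma cone_excess_meet_id tau f x y :
  meet (fun i => sign_order (tau i)) x y = x -> cone_excess tau f x y = 0.
Proof.
move=> mE; have jE : join (fun i => sign_order (tau i)) x y = y.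
  apply/ffunP => i; move/ffunP/(_ i): mE; rewrite !ffunE.
  by case: ifP.
by rewrite /cone_excess /excess mE jE subrr.
Qed.

Lemma cone_excessD tau f g x y :
  cone_excess tau (fun z => f z + g z) x y =
  cone_excess tau f x y + cone_excess tau g x y.
Proof. by rewrite /cone_excess /excess; lra. Qed.

Lemma cone_excess_sum tau (I : finType) (F : I -> cube n -> R) x y :
  cone_excess tau (fun z => \sum_i F i z) x y =
  \sum_i cone_excess tau (F i) x y.
Proof. by rewrite /cone_excess /excess sumrB !big_split. Qed.

(** Raising the value of f at x by a small amount keeps f in the cone and
    strictly decreases its excess at (x, y), because x is neither the meet nor
    the join; so the excess of f itself cannot vanish. *)
Lemma interior_excess_gt0 tau f x y :
    interior_supermodular_cone tau f ->
    x != meet (fun i => sign_order (tau i)) x y ->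
    x != join (fun i => sign_order (tau i)) x y ->
  0 < cone_excess tau f x y.
Proof.
move=> fint xm xj.
have xy : x != y.
  apply: contra_neq xm => ->; apply/ffunP => i.
  by rewrite ffunE if_same.
have : \forall e \near (f x : R),
    supermodular_cone tau (@dfwith _ (fun=> R) f x e).
  apply: (@dfwith_continuous (cube n) (fun=> R) f x (f x)).
  suff -> : @dfwith _ (fun=> R) f x (f x) = f by [].
  by apply/funext => z; case: dfwithP.
move=> /nbhs_ballP[e /= e0 he].
have /supermodular_coneP/(_ x y) : supermodular_cone tau
    (@dfwith _ (fun=> R) f x (f x + e / 2)).
  apply: he; rewrite /ball /= opprD addNKr normrN gtr0_norm ?divr_gt0 //.
  by rewrite ltr_pdivrMr // ltr_pMr // ltr1n.
rewrite /cone_excess /excess dfwithin !dfwithout //.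
lra.
Qed.

End Excess.

(** * The functions star k and the upper bound *)

Section Star.
Variable n : nat.
Implicit Types (x y : cube n) (k : 'I_n).

Definition others k x : nat := \sum_(j | j != k) x j.

Definition diff y x : cube n := [ffun i => y i && ~~ x i].

(** The number of edges from k inside the support of x, as a subset of the
    complete graph on the coordinates. *)
Definition star k x : nat := x k * others k x.

Local Notation pi tau := (fun i => sign_order (tau i)).

(** Only pairs with x_k != y_k matter; if x_k = 1 and y_k = 0, reversing
    coordinate k puts the 1 on the side of the meet, where the remaining sum is
    at most that of x. *)
Lemma star_minus_at k x y :
  (star k (meet (pi (minus_at k)) x y) + star k (join (pi (minus_at k)) x y)
   <= star k x + star k y)%N.
Proof.
set m := meet _ x y; set j := join _ x y.
have mE i : m i = if i == k then x i || y i else x i && y i.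
  by rewrite !ffunE /sign_order; case: eqP; case: (x i); case: (y i).
have jE i : j i = if i == k then x i && y i else x i || y i.
  by rewrite !ffunE /sign_order; case: eqP; case: (x i); case: (y i).
have sum_mj : (others k m + others k j =
               others k x + others k y)%N.
  rewrite /others -!big_split; apply: eq_bigr => i /negbTE ik.
  by rewrite mE jE ik; case: (x i); case: (y i).
have le_mx : (others k m <= others k x)%N.
  apply: leq_sum => i /negbTE ik.
  by rewrite mE ik; case: (x i); case: (y i).
have le_my : (others k m <= others k y)%N.
  apply: leq_sum => i /negbTE ik.
  by rewrite mE ik; case: (x i); case: (y i).
rewrite /star mE jE eqxx; case: (x k); case: (y k); rewrite /=; lia.
Qed.

(** In the usual order the 1 in coordinate k goes with the join instead, whose
    remaining sum exceeds that of x by the size of diff y x. *)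
Lemma star_all_plus k x y :
  (star k x + star k y + (x k * ~~ y k * others k (diff y x))
   <= star k (meet (pi (all_plus n)) x y)
      + star k (join (pi (all_plus n)) x y))%N.
Proof.
set m := meet _ x y; set j := join _ x y.
have mE i : m i = x i && y i.
  by rewrite !ffunE /sign_order; case: (x i); case: (y i).
have jE i : j i = x i || y i.
  by rewrite !ffunE /sign_order; case: (x i); case: (y i).
have sum_mj : (others k m + others k j =
               others k x + others k y)%N.
  rewrite /others -!big_split; apply: eq_bigr => i _.
  by rewrite mE jE; case: (x i); case: (y i).
have sum_jx : (others k j =
               others k x + others k (diff y x))%N.
  rewrite /others -!big_split; apply: eq_bigr => i _.
  by rewrite jE ffunE; case: (x i); case: (y i).
have le_yj : (others k y <= others k j)%N.
  apply: leq_sum => i _.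
  by rewrite jE; case: (x i); case: (y i).
rewrite /star mE jE; case: (x k); case: (y k); rewrite /=; lia.
Qed.

Lemma incomparable_witness x y : meet (pi (all_plus n)) x y != x ->
  exists2 i, x i & ~~ y i.
Proof.
move=> xm; have /existsP[i /andP[xi yi]] : [exists i, x i && ~~ y i].
  apply: contraNT xm => /existsPn xy; apply/eqP/ffunP => i.
  by rewrite !ffunE /sign_order; have := xy i; case: (x i); case: (y i).
by exists i.
Qed.

Lemma star_all_plus_lt k i x y : x k -> ~~ y k -> y i -> ~~ x i ->
  (star k x + star k y < star k (meet (pi (all_plus n)) x y)
      + star k (join (pi (all_plus n)) x y))%N.
Proof.
move=> xk yk yi xi; apply: leq_trans (star_all_plus k x y).
rewrite -addn1 leq_add2l xk yk !mul1n /others (bigD1 i) /= ?ffunE ?yi ?xi //.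
by apply: contraNneq yk => <-.
Qed.

End Star.

Section Rank.
Local Open Scope ring_scope.
Variable R : realType.

Lemma star_submodular n (k : 'I_n) (c : R) : 0 <= c ->
  submodular_cone (minus_at k) (fun x => c * (star k x)%:R).
Proof.
move=> c0; apply/submodular_coneP => x y.
rewrite /cone_excess /excess -!mulrDr -mulrBr mulr_ge0_le0 // subr_le0.
by rewrite -!natrD ler_nat star_minus_at.
Qed.

Lemma star_cone_excess n (k : 'I_n) x y :
  0 <= cone_excess (all_plus n) (fun z => (star k z)%:R : R) x y.
Proof.
rewrite /cone_excess /excess subr_ge0 -!natrD ler_nat.
exact: leq_trans (leq_addr _ _) (star_all_plus k x y).
Qed.

(** One summand can be spared: of the two coordinates i and j where x and y
    differ in opposite directions, at most one is ord0, and by symmetry in x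
    and y the other can be taken to be i. *)
Lemma star_sum_excess_ge1 n (x y : cube n.+1) (i j : 'I_n.+1) :
    x i -> ~~ y i -> y j -> ~~ x j ->
  1 <= cone_excess (all_plus n.+1)
         (fun z => \sum_(k < n) (star (lift ord0 k) z)%:R : R) x y.
Proof.
wlog i0 : x y i j / i != ord0.
  move=> wl xi yi yj xj; have [i0|] := eqVneq i ord0; last first.
    by move=> /(wl x y i j); apply.
  have j0 : j != ord0 by apply: contraNneq xj => ->; rewrite -i0.
  by rewrite cone_excessC; apply: (wl y x j i).
move=> xi yi yj xj.
have [k ik] : exists k, i = lift ord0 k.
  by move: i0; rewrite eq_sym => /unlift_some[k -> _]; exists k.
rewrite cone_excess_sum (bigD1 k) //= -[leLHS]addr0 lerD //; last first.
  by apply: sumr_ge0 => l _; apply: star_cone_excess.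
rewrite /cone_excess /excess lerBrDr -!natrD nat1r ler_nat -ik.
exact: (star_all_plus_lt xi yi yj xj).
Qed.

(** On comparable pairs the excess of f vanishes, on incomparable ones that of
    q is at least 1, so a large multiple of q absorbs f. *)
Lemma elementary_decomposition_exists n (f : cube n.+1 -> R) :
  elementary_decomposition f n.
Proof.
(* A crude constant that dominates every excess of f. *)
pose c : R := \sum_(p : cube n.+1 * cube n.+1)
  `|cone_excess (all_plus n.+1) f p.1 p.2|.
pose q (z : cube n.+1) : R := \sum_(k < n) (star (lift ord0 k) z)%:R.
have c0 : 0 <= c by apply: sumr_ge0.
exists (fun z => f z - c * q z), (lift ord0),
  (fun k z => c * (star (lift ord0 k) z)%:R); split; last first.
- by move=> x; rewrite -mulr_sumr subrK.
- by move=> k; apply: star_submodular.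
apply/submodular_coneP => x y.
have -> : cone_excess (all_plus n.+1) (fun z => f z - c * q z) x y =
    cone_excess (all_plus n.+1) f x y - c * cone_excess (all_plus n.+1) q x y.
  by rewrite /cone_excess /excess; lra.
rewrite subr_le0.
have q_ge0 : 0 <= cone_excess (all_plus n.+1) q x y.
  by rewrite cone_excess_sum sumr_ge0 // => k _; apply: star_cone_excess.
have [mx|/incomparable_witness[i xi yi]] := eqVneq
    (meet (fun i => sign_order (all_plus n.+1 i)) x y) x.
  by rewrite (cone_excess_meet_id _ mx) mulr_ge0.
have [my|/incomparable_witness[j yj xj]] := eqVneq
    (meet (fun i => sign_order (all_plus n.+1 i)) y x) y.
  by rewrite cone_excessC (cone_excess_meet_id _ my) mulr_ge0.
have fc : cone_excess (all_plus n.+1) f x y <= c.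
  apply: le_trans (ler_norm _) _.
  rewrite /c (bigD1 (x, y)) //= lerDl; exact: sumr_ge0.
apply: (le_trans fc); rewrite ler_peMr //.
exact: star_sum_excess_ge1 xi yi yj xj.
Qed.

(** * The pairs of unit points and the lower bound *)

Definition unit_point n (i : 'I_n) : cube n := [ffun k => k == i].

(** The points e_i and e_j agree away from i and j, so the orders on the other
    coordinates do not affect their meet and join. *)
Lemma cone_excess_units n (tau : sign_vector n) (f : cube n -> R) (i j : 'I_n) :
    tau i = false -> tau j = false ->
  cone_excess tau f (unit_point i) (unit_point j) =
  cone_excess (all_plus n) f (unit_point i) (unit_point j).
Proof.
move=> ti tj; rewrite /cone_excess /excess; congr (f _ + f _ - _);
  apply/ffunP => k; rewrite !ffunE /sign_order;
  have [->|ki] := eqVneq k i; rewrite ?ti ?if_same //;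
  have [->|kj] := eqVneq k j; rewrite ?tj ?if_same //.
Qed.

(** The indices of the summands miss two coordinates i != j, for which
    cone_excess_units lets every summand count as submodular. *)
Lemma elementary_decomposition_units n (f : cube n -> R) r :
    elementary_decomposition f r -> (r.+1 < n)%N ->
  exists i j, i != j /\
    cone_excess (all_plus n) f (unit_point i) (unit_point j) <= 0.
Proof.
move=> [f0 [k [g [f0sub gsub fE]]]] rn.
have : (1 < #|~: [set k l | l : 'I_r]|)%N.
  rewrite -(leq_add2l #|[set k l | l : 'I_r]|) cardsC card_ord addn2.
  apply: leq_trans rn.
  by rewrite !ltnS (leq_trans (leq_imset_card _ _)) ?card_ord.
move=> /card_gt1P[i [j [iC jC ij]]]; exists i, j; split => //.
have out a l : a \in ~: [set k l | l : 'I_r] -> minus_at (k l) a = false.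
  by rewrite inE ffunE => aC; apply: contraNF aC => /eqP ->; apply: imset_f.
have -> : f = fun x => f0 x + \sum_(l < r) g l x by apply/funext.
rewrite cone_excessD cone_excess_sum -[leRHS]addr0 lerD //.
  by have /submodular_coneP := f0sub; apply.
apply: sumr_le0 => l _.
have /submodular_coneP/(_ (unit_point i) (unit_point j)) := gsub l.
by rewrite cone_excess_units // out.
Qed.

Lemma elementary_submodular_rank_full n (f : cube n -> R) : (0 < n)%N ->
    (forall i j, i != j ->
      0 < cone_excess (all_plus n) f (unit_point i) (unit_point j)) ->
  elementary_submodular_rank f n.
Proof.
case: n f => // n f _ fgt0; split.
  by exists n => //; apply: elementary_decomposition_exists.
move=> _ [r /= fr <-]; rewrite leqNgt; apply/negP.
move=> /(elementary_decomposition_units fr).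
by move=> [i [j [/fgt0 ij]]]; rewrite leNgt ij.
Qed.

Lemma unit_point_neq_meet n (i j : 'I_n) : i != j ->
  unit_point i !=
  meet (fun k => sign_order (all_plus n k)) (unit_point i) (unit_point j).
Proof.
move=> ij; apply/eqP => /ffunP/(_ i).
by rewrite !ffunE /sign_order eqxx (negbTE ij).
Qed.

Lemma unit_point_neq_join n (i j : 'I_n) : i != j ->
  unit_point i !=
  join (fun k => sign_order (all_plus n k)) (unit_point i) (unit_point j).
Proof.
move=> ij; apply/eqP => /ffunP/(_ j).
by rewrite !ffunE /sign_order eqxx eq_sym (negbTE ij).
Qed.

Lemma elementary_submodular_rank_le n (f : cube n -> R) k : (0 < n)%N ->
  elementary_submodular_rank f k -> (k <= n)%N.
Proof.
case: n f => // n f _ [_]; apply.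
by exists n => //; apply: elementary_decomposition_exists.
Qed.

Lemma elementary_submodular_rank_exists n (f : cube n -> R) : (0 < n)%N ->
  exists k, elementary_submodular_rank f k.
Proof.
case: n f => // n f _.
have ex : exists r, `[< elementary_decomposition f r >].
  by exists n; apply/asboolP/elementary_decomposition_exists.
exists (ex_minn ex).+1; case: ex_minnP => r /asboolP fr rmin; split.
  by exists r.
by move=> _ [s /= fs <-]; rewrite ltnS rmin //; apply/asboolP.
Qed.

Lemma elementary_submodular_rank_attained n : (0 < n)%N ->
  exists f : cube n -> R, elementary_submodular_rank f n.
Proof.
case: n => // n _.
exists (fun z => \sum_(k < n) (star (lift ord0 k) z)%:R).
apply: elementary_submodular_rank_full => // i j ij.
apply: lt_le_trans ltr01 (@star_sum_excess_ge1 _ _ _ i j _ _ _ _);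
  by rewrite ffunE ?eqxx // 1?eq_sym.
Qed.

End Rank.

Theorem theorem14 (R : realType) (n : nat) (hn : (3 <= n)%N) :
  [/\ (forall f : cube n -> R, exists k, elementary_submodular_rank f k),
      is_maximum
        [set k | exists f : cube n -> R, elementary_submodular_rank f k] n &
      forall f : cube n -> R,
        interior_supermodular_cone (all_plus n) f ->
        elementary_submodular_rank f n].
Proof.
have n0 : (0 < n)%N by apply: leq_trans hn.
split; first by move=> f; apply: elementary_submodular_rank_exists.
  split; first exact: elementary_submodular_rank_attained.
  by move=> k [f]; apply: elementary_submodular_rank_le.
move=> f fint; apply: elementary_submodular_rank_full => // i j ij.
apply: interior_excess_gt0 => //.
  exact: unit_point_neq_meet.
exact: unit_point_neq_join.
Qed.
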